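(* Let $L_1$ and $L_2$ be non-abelian finite-dimensional Lie algebras over the field $\mathbb{F}_2$ such that $G_{L_1}\cong G_{L_2}$ as graphs. Then $|L_1|=|L_2|$.
   Context: $\mathbb{F}_2$ is the field with two elements. For a Lie algebra $L$, $Z(L)=\{x\in L : [x,y]=0 \text{ for all } y\in L\}$ is its centre. The non-commuting graph $G_L$ is the undirected simple graph with vertex set $L\setminus Z(L)$, in which two distinct vertices $x$ and $y$ are adjacent if and only if $[x,y]\neq 0$. $|L|$ is the number of elements of $L$. *)

(* Defs.v *)
From HB Require Import structures.
From mathcomp Require Import all_boot all_algebra all_field.

Set Implicit Arguments.
Unset Strict Implicit.
Unset Printing Implicit Defensive.

Import GRing.Theory.
Local Open Scope ring_scope.

(* The bracket is required to be alternating, not merely antisymmetric: in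
   characteristic 2 the former is strictly stronger. *)
HB.mixin Record Lmodule_isLieAlgebra (K : fieldType) L of GRing.Lmodule K L := {
  lie_bracket : L -> L -> L;
  lie_bracket_linearl : forall z : L, linear (lie_bracket^~ z);
  lie_bracket_linearr : forall z : L, linear (lie_bracket z);
  lie_bracketxx : forall x : L, lie_bracket x x = 0;
  lie_jacobi : forall x y z : L,
    lie_bracket x (lie_bracket y z) + lie_bracket y (lie_bracket z x)
      + lie_bracket z (lie_bracket x y) = 0
}.

#[short(type="lieAlgType")]
HB.structure Definition LieAlgebra (K : fieldType) :=
  { L of Lmodule_isLieAlgebra K L & GRing.Lmodule K L }.

#[short(type="finDimLieAlgType")]
HB.structure Definition FinDimLieAlgebra (K : fieldType) :=
  { L of LieAlgebra K L & Vector K L }.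

Definition lie_abelian (K : fieldType) (L : lieAlgType K) : Prop :=
  forall x y : L, lie_bracket x y = 0.

Record sgraph := SGraph {
  vertex :> finType;
  adj : rel vertex;
  adj_sym : symmetric adj;
  adj_irrefl : irreflexive adj
}.

Definition graph_isomorphic (G H : sgraph) : Prop :=
  exists2 f : G -> H, bijective f & forall x y : G, adj (f x) (f y) = adj x y.

Section NonCommutingGraph.

(* [finvect_type L] is [L] itself, seen as a finite type. *)
Variables (F : finFieldType) (L : finDimLieAlgType F).

Definition lie_center : {set finvect_type L} :=
  [set x : finvect_type L |
    [forall y : finvect_type L, lie_bracket (x : L) (y : L) == 0]].

Definition nc_vertex : finType := {x : finvect_type L | x \notin lie_center}.

Definition nc_adj : rel nc_vertex :=
  fun x y => (x != y) && (lie_bracket (val x : L) (val y : L) != 0).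

Lemma lie_bracketC (x y : L) : lie_bracket x y = - lie_bracket y x.
Proof.
have addl (u v w : L) :
    lie_bracket (u + v) w = lie_bracket u w + lie_bracket v w.
  by have := lie_bracket_linearl w 1 u v; rewrite !scale1r.
have addr (u v w : L) :
    lie_bracket w (u + v) = lie_bracket w u + lie_bracket w v.
  by have := lie_bracket_linearr w 1 u v; rewrite !scale1r.
apply/eqP; rewrite -addr_eq0; apply/eqP.
by have := lie_bracketxx (x + y);
  rewrite addl !addr !lie_bracketxx add0r addr0.
Qed.

Lemma nc_adj_sym : symmetric nc_adj.
Proof. by move=> x y; rewrite /nc_adj eq_sym lie_bracketC oppr_eq0. Qed.

Lemma nc_adj_irrefl : irreflexive nc_adj.
Proof. by move=> x; rewrite /nc_adj eqxx. Qed.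

Definition non_commuting_graph : sgraph := SGraph nc_adj_sym nc_adj_irrefl.

End NonCommutingGraph.

(* Main.v *)
Require Import Defs.
From HB Require Import structures.
From mathcomp Require Import all_boot all_algebra all_field.

Set Implicit Arguments.
Unset Strict Implicit.
Unset Printing Implicit Defensive.

Import GRing.Theory.

(** The isomorphism matters only through the number of vertices, which for a
    Lie algebra [L] over a field with [q] elements is
    [#|L| - #|Z(L)| = q ^ n - q ^ a], where [n] and [a] are the dimensions of
    [L] and of its centre; the centre is a subspace, being an intersection of
    kernels of linear maps ([card_lie_center]). When [L] is not abelian,
    [a < n], so [q ^ n - q ^ a = q ^ a * (q ^ (n - a) - 1)] with the second
    factor prime to [q]: the exact power of [q] in the number of vertices gives
    [a], and then the number of vertices gives [n] ([expn_sub_inj]). *)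

(** If [a] were smaller than [b], then [q ^ a.+1] would divide every term of the
    equation other than [q ^ a]. *)
Lemma expn_sub_inj q n m a b :
    1 < q -> a < n -> b < m -> q ^ n - q ^ a = q ^ m - q ^ b -> n = m.
Proof.
move=> q_gt1; wlog le_ab : n m a b / a <= b => [wlog_le|] lt_an lt_bm eq_sub.
  have [le_ab|/ltnW le_ba] := leqP a b; first exact: (wlog_le _ _ a b).
  by apply/esym/(wlog_le _ _ b a).
have le_qan : q ^ a <= q ^ n by rewrite leq_exp2l // ltnW.
have le_qbm : q ^ b <= q ^ m by rewrite leq_exp2l // ltnW.
move: le_ab; rewrite leq_eqVlt => /predU1P[eq_ab | lt_ab].
  apply: (expnI q_gt1); rewrite -(subnK le_qan) -(subnK le_qbm).
  by rewrite eq_sub eq_ab.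
have : q ^ a.+1 %| q ^ a.
  have dvd_sub : q ^ a.+1 %| q ^ n - q ^ a.
    by rewrite eq_sub dvdn_sub // dvdn_exp2l // (ltn_trans lt_ab).
  by rewrite -(dvdn_addr _ dvd_sub) subnK // dvdn_exp2l.
by rewrite dvdn_Pexp2l // ltnn.
Qed.

Section Center.

Variables (F : finFieldType) (L : finDimLieAlgType F).

Lemma card_finvect_subspace (V : {vspace L}) :
  #|[pred x : finvect_type L | (x : L) \in V]| = #|F| ^ \dim V.
Proof. exact: (@card_vspace F (finvect_type L) (Vector.class _) V). Qed.

Lemma card_finvect : #|finvect_type L| = #|F| ^ \dim {: L}.
Proof.
by rewrite -card_finvect_subspace; apply: eq_card => x; rewrite !inE memvf.
Qed.

Definition lie_bracket_hom (y : L) : 'Hom(L, L) :=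
  linfun (HB.pack_for {linear L -> L} (fun x : L => lie_bracket x y)
    (GRing.isLinear.Build F L L _ _ (lie_bracket_linearl y))).

Lemma lie_bracket_homE (x y : L) : lie_bracket_hom y x = lie_bracket x y.
Proof. by rewrite lfunE. Qed.

Definition lie_center_vspace : {vspace L} :=
  (\bigcap_(y : finvect_type L) lker (lie_bracket_hom y))%VS.

Lemma mem_lie_center_vspace (x : finvect_type L) :
  ((x : L) \in lie_center_vspace) = (x \in lie_center L).
Proof.
rewrite inE memvE; apply/subv_bigcapP/forallP => [xZ y | xZ y _].
  by have := xZ y isT; rewrite -memvE memv_ker lie_bracket_homE.
by rewrite -memvE memv_ker lie_bracket_homE.
Qed.

Lemma card_lie_center : #|lie_center L| = #|F| ^ \dim lie_center_vspace.
Proof.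
rewrite -card_finvect_subspace; apply: eq_card => x.
by rewrite -mem_lie_center_vspace.
Qed.

Lemma dim_lie_center_lt :
  ~ lie_abelian L -> \dim lie_center_vspace < \dim {: L}.
Proof.
move=> nabL; rewrite ltn_neqAle dimvS ?subvf // andbT.
apply/negP => /eqP eq_dim; apply: nabL => x y.
have /eqP eqZ : lie_center_vspace == fullv by rewrite eqEdim subvf eq_dim /=.
have := memvf x; rewrite -eqZ (mem_lie_center_vspace x) inE.
by move=> /forallP/(_ y)/eqP.
Qed.

Lemma card_nc_vertex :
  #|nc_vertex L| = #|F| ^ \dim {: L} - #|F| ^ \dim lie_center_vspace.
Proof.
by rewrite card_sig -card_finvect -card_lie_center -(cardC (lie_center L)) addKn.
Qed.

End Center.

Lemma card_eq_of_card_nc_vertex (F : finFieldType) (L1 L2 : finDimLieAlgType F) :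
    ~ lie_abelian L1 -> ~ lie_abelian L2 ->
    #|nc_vertex L1| = #|nc_vertex L2| ->
  #|finvect_type L1| = #|finvect_type L2|.
Proof.
move=> nab1 nab2; rewrite !card_nc_vertex !card_finvect => eq_card.
congr (_ ^ _); apply: expn_sub_inj eq_card; first exact: finNzRing_gt1.
  exact: dim_lie_center_lt.
exact: dim_lie_center_lt.
Qed.

Theorem proposition4p6 (L1 L2 : finDimLieAlgType 'F_2) :
  ~ lie_abelian L1 -> ~ lie_abelian L2 ->
  graph_isomorphic (non_commuting_graph L1) (non_commuting_graph L2) ->
  #|finvect_type L1| = #|finvect_type L2|.
Proof.
move=> nab1 nab2 [f bij_f _].
exact: card_eq_of_card_nc_vertex nab1 nab2 (bij_eq_card bij_f).
Qed.
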